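(* Let $t\ge 2$ be an integer and let $A$ be a $t\times t$-partite zero-one matrix. Then $$\operatorname{ex}(n,A)<n^{2-\frac{1}{t}+o(1)},$$ that is, for every $\varepsilon>0$ there exists $n_0$ such that $\operatorname{ex}(n,A)<n^{2-\frac1t+\varepsilon}$ for all $n\ge n_0$.
   Context: A zero-one matrix $M$ contains a zero-one matrix $A$ if one can delete some rows and columns of $M$ and turn some $1$-entries into $0$-entries so that the resulting matrix is $A$. The weight of a matrix is its number of $1$-entries, and $\operatorname{ex}(n,A)$ is the maximum weight of an $n\times n$ zero-one matrix not containing $A$. A matrix is column-$t$-partite if its columns can be cut into $t$ consecutive intervals, giving $t$ submatrices, such that every row of each submatrix contains at most one $1$-entry; it is row-$t$-partite if its rows can be cut into $t$ consecutive intervals, giving $t$ submatrices, such that every column of each submatrix contains at most one $1$-entry. A matrix is $t\times t$-partite if it is both row-$t$-partite and column-$t$-partite. *)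

(* Defs.v *)
From mathcomp Require Import all_boot all_algebra.
From Stdlib Require Import Reals.
Set Implicit Arguments. Unset Strict Implicit. Unset Printing Implicit Defensive.

Definition incr_ord (a b : nat) (f : {ffun 'I_a -> 'I_b}) : bool :=
  [forall i : 'I_a, forall i' : 'I_a, (i < i')%N ==> (f i < f i')%N].

(* M contains A: delete rows/columns of M and turn some 1s into 0s to get A,
   i.e. there are increasing row/column selections f, g with
   A i j = 1 -> M (f i) (g j) = 1. *)
Definition contains (m k r c : nat) (M : 'M[bool]_(m, k)) (A : 'M[bool]_(r, c)) : bool :=
  [exists f : {ffun 'I_r -> 'I_m}, exists g : {ffun 'I_c -> 'I_k},
     [&& incr_ord f, incr_ord g &
         [forall i, forall j, A i j ==> M (f i) (g j)]]].

Definition weight (m k : nat) (M : 'M[bool]_(m, k)) : nat :=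
  #|[set ij : 'I_m * 'I_k | M ij.1 ij.2]|.

Definition ex (n r c : nat) (A : 'M[bool]_(r, c)) : nat :=
  \max_(M : 'M[bool]_(n, n) | ~~ contains M A) weight M.

(* Column-t-partite: columns cut into t consecutive (possibly empty) intervals,
   encoded by a nondecreasing labelling h of columns by 'I_t; in each interval
   every row has at most one 1-entry. *)
Definition col_partite (t r c : nat) (A : 'M[bool]_(r, c)) : Prop :=
  exists h : 'I_c -> 'I_t,
    (forall j j' : 'I_c, (j <= j')%N -> (h j <= h j')%N) /\
    (forall (i : 'I_r) (j j' : 'I_c), h j = h j' -> A i j -> A i j' -> j = j').

Definition row_partite (t r c : nat) (A : 'M[bool]_(r, c)) : Prop :=
  exists h : 'I_r -> 'I_t,
    (forall i i' : 'I_r, (i <= i')%N -> (h i <= h i')%N) /\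
    (forall (j : 'I_c) (i i' : 'I_r), h i = h i' -> A i j -> A i' j -> i = i').

Definition txt_partite (t r c : nat) (A : 'M[bool]_(r, c)) : Prop :=
  row_partite t A /\ col_partite t A.

(* Main.v *)
Require Import Defs.
From mathcomp Require Import all_boot all_algebra.
From mathcomp Require Import zify.
Set Implicit Arguments. Unset Strict Implicit. Unset Printing Implicit Defensive.

(* Let [M] have at least n^(2-1/t+eps) ones.  Call a pair [(x, s)] a star when
   [s] is a t-tuple of columns, all with a one in row [x]; by convexity there are
   at least n^(t+t*eps) stars up to a constant.  Cut the rows into nested K-adic
   intervals.  If, along the path from the root to [x], every interval has at
   most [r] children meeting the common rows of [s], the star is bad; a tree with
   branching at most [r] and height about log_K n has at most n^(t*eps/2) leaves
   when [K] is large, so few stars are bad.  Hence for some row [x] of large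
   degree half of its stars are good, and there are only O(log n) possibilities
   for the interval at which branching happens and for the children met.  One of
   them is shared by a 1/O(log n) proportion of the stars at [x], and Erdos'
   box theorem gives column sets Y_1 < ... < Y_t all of whose transversals have
   common rows in the same [r] disjoint intervals, which embeds [A]. *)

(** * Counting tuples in boxes *)

Fixpoint box_sum (X : finType) (Js : seq {set X}) (F : seq X -> nat) : nat :=
  if Js is J :: Js' then \sum_(y in J) box_sum Js' (fun s => F (y :: s))
  else F [::].

Definition in_box (X : finType) (s : seq X) (Js : seq {set X}) : bool :=
  all2 (fun y (J : {set X}) => y \in J) s Js.

Section BoxSum.
Variable X : finType.
Implicit Types (J Y : {set X}) (Js : seq {set X}) (F G : seq X -> nat).

Lemma leq_box_sum Js F G :
  (forall s, in_box s Js -> F s <= G s) -> box_sum Js F <= box_sum Js G.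
Proof.
elim: Js F G => [|J Js IH] F G le_FG /=; first exact: le_FG.
by apply: leq_sum => y yJ; apply: IH => s sJs; apply: le_FG; rewrite /in_box /= yJ.
Qed.

Lemma eq_box_sum Js F G : F =1 G -> box_sum Js F = box_sum Js G.
Proof.
by move=> eFG; apply/eqP; rewrite eqn_leq !leq_box_sum // => s _; rewrite eFG.
Qed.

Lemma box_sum_sum Js (I : finType) (P : pred I) (F : I -> seq X -> nat) :
  box_sum Js (fun s => \sum_(i | P i) F i s) = \sum_(i | P i) box_sum Js (F i).
Proof.
elim: Js F => [|J Js IH] F //=.
by rewrite exchange_big /=; apply: eq_bigr => y _; rewrite IH.
Qed.

Lemma box_sumD Js F G :
  box_sum Js (fun s => F s + G s) = box_sum Js F + box_sum Js G.
Proof.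
elim: Js F G => [|J Js IH] F G //=.
by rewrite -big_split; apply: eq_bigr => y _; rewrite IH.
Qed.

Lemma box_sumMl Js k F : box_sum Js (fun s => k * F s) = k * box_sum Js F.
Proof.
elim: Js F => [|J Js IH] F //=.
by rewrite big_distrr; apply: eq_bigr => y _; rewrite IH.
Qed.

Lemma box_sum_const Js m k : all (fun J => #|J| == m) Js ->
  box_sum Js (fun=> k) = k * m ^ size Js.
Proof.
elim: Js => [|J Js IH] /=; first by rewrite muln1.
by case/andP=> /eqP cardJ /IH->; rewrite sum_nat_const cardJ expnS mulnCA.
Qed.

(** Boxes that vary with a row become comparable once all are enlarged to the full power and
    membership is moved into the summand. *)
Lemma box_sum_setT Js F :
  box_sum Js F = box_sum (nseq (size Js) setT) (fun s => in_box s Js * F s).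
Proof.
elim: Js F => [|J Js IH] F /=; first by rewrite mul1n.
rewrite [RHS](bigID (mem J)) /= [X in _ + X]big1 ?addn0; last first.
  move=> y /andP[_ /negPf yJ]; rewrite (eq_box_sum _ (G := fun=> 0 * 0)) ?box_sumMl //.
  by move=> s; rewrite /in_box /= yJ.
apply: eq_big => [y|y yJ]; first by rewrite inE.
by rewrite IH; apply: eq_box_sum => s; rewrite /in_box /= yJ.
Qed.

End BoxSum.

(** * Erdős' box theorem *)

Lemma card_sum (X : finType) (J : {set X}) (P : pred X) :
  \sum_(y in J) (P y : nat) = #|[set y in J | P y]|.
Proof.
rewrite -sum1_card big_mkcond [RHS]big_mkcond /=; apply: eq_bigr => y _.
by rewrite inE; case: (y \in J); case: (P y).
Qed.

(** The elements of [Y] are chosen one by one. After [j < c] choices every surviving tuple keeps at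
    least [m/(2p) - j >= m/(4p)] neighbours in [J] outside [Y]; averaging over at most [m]
    candidates gives one that retains a [1/(4p)] share of the survivors. *)
Lemma greedy_pick (X : finType) (J : {set X}) (Js : seq {set X}) (m p c : nat)
    (P : X -> seq X -> bool) (E : seq X -> bool) :
  0 < p -> 0 < m -> #|J| = m -> 4 * p * c <= m -> 0 < box_sum Js E ->
  (forall s, E s -> m <= 2 * p * \sum_(y in J) P y s) ->
  exists Y : {set X}, [/\ Y \subset J, #|Y| = c &
    box_sum Js E <=
      (4 * p) ^ c * box_sum Js (fun s => E s && [forall y in Y, P y s])].
Proof.
move=> p0 m0 cJ cm E0 degE.
suff H j : j <= c -> exists Y : {set X}, [/\ Y \subset J, #|Y| = j &
    box_sum Js E <=
      (4 * p) ^ j * box_sum Js (fun s => E s && [forall y in Y, P y s])].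
  exact: H.
elim: j => [_|j IH jc].
  exists set0; rewrite sub0set cards0; split=> //; rewrite mul1n.
  apply: leq_box_sum => s _; case: (E s) => //=.
  by rewrite lt0b; apply/forall_inP => y; rewrite inE.
have [Y [sYJ cY leY]] := IH (ltnW jc).
pose EY s := E s && [forall y in Y, P y s].
have {}leY : box_sum Js E <= (4 * p) ^ j * box_sum Js EY by [].
have EY0 : 0 < box_sum Js EY.
  by move: (leq_trans E0 leY); rewrite muln_gt0 => /andP[].
pose EYy y s := E s && [forall z in y |: Y, P z s].
have le1 : m * box_sum Js EY <= 4 * p * \sum_(y in J :\: Y) box_sum Js (EYy y).
  rewrite -box_sum_sum -!box_sumMl; apply: leq_box_sum => s _.
  rewrite /EY; case Es: (E s) => /=; last by rewrite muln0.
  case: (boolP [forall y in Y, P y s]) => [/forall_inP PY|_]; last by rewrite /= muln0.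
  rewrite /= muln1.
  have -> : \sum_(y in J :\: Y) (EYy y s : nat) = \sum_(y in J :\: Y) (P y s : nat).
    apply: eq_bigr => y _; rewrite /EYy Es /=; congr nat_of_bool.
    apply/forall_inP/idP => [H|Py z]; first by apply: H; rewrite setU11.
    by rewrite !inE => /orP[/eqP->|/PY].
  have := degE s Es.
  rewrite !card_sum => degs.
  have : #|[set y in J | P y s]| <= #|[set y in J :\: Y | P y s]| + j.
    rewrite -cY -[#|[set y in J | P y s]|](cardsID Y) addnC leq_add //.
      by apply: subset_leq_card; apply/subsetP=> y; rewrite !inE; case: (y \in Y);
        case: (y \in J); case: (P y s).
    by apply: subset_leq_card; apply: subsetIr.
  nia.
have [/exists_inP[y yJY ley]|/exists_inPn none] :=
    boolP [exists y in J :\: Y, box_sum Js EY <= 4 * p * box_sum Js (EYy y)].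
  exists (y |: Y); move: yJY; rewrite inE => /andP[yY yJ]; split.
  - by rewrite subUset sub1set yJ.
  - by rewrite cardsU1 yY cY.
  - by apply: (leq_trans leY); rewrite expnSr -mulnA leq_mul2l ley orbT.
(* If every candidate fails, integrality gains 1 in each term, so the sum stays below
   [m * box_sum Js EY], against [le1]. *)
have : 4 * p * \sum_(y in J :\: Y) box_sum Js (EYy y) <=
       \sum_(y in J :\: Y) (box_sum Js EY).-1.
  rewrite big_distrr; apply: leq_sum => y /none.
  by rewrite -ltnNge => lt; rewrite -ltnS prednK.
rewrite sum_nat_const => le2.
have le3 : #|J :\: Y| <= m by rewrite -cJ subset_leq_card ?subsetDl.
nia.
Qed.

(* Erdős' theorem on complete t-partite t-graphs, with polynomial dependence on
   the inverse density p. *)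
Lemma dense_box (c t : nat) : exists C e : nat, 0 < C /\
  forall (p m : nat), 0 < p -> C * p ^ e <= m ->
  forall (X : finType) (Js : seq {set X}) (P : seq X -> bool),
  size Js = t -> all (fun J : {set X} => #|J| == m) Js ->
  m ^ t <= p * box_sum Js P ->
  exists Ys : seq {set X}, [/\ size Ys = t,
    forall l, l < t -> nth set0 Ys l \subset nth set0 Js l /\ #|nth set0 Ys l| = c &
    forall s, in_box s Ys -> P s].
Proof.
elim: t => [|t [C [e [C0 IH]]]].
  exists 1, 0; split=> // p m p0 _ X [|//] P _ _ /= Ple; exists [::]; split=> // -[|//] _.
  by move: Ple; case: (P [::]); rewrite // muln0.
(* The first summand yields [4pc <= m] for [greedy_pick]; the second serves the induction hypothesis
   at the inverse density [2p(4p)^c] left after [Y] is chosen. *)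
exists (4 * c + C * (2 * 4 ^ c) ^ e), (c.+1 * e).+1; split=> [|p m p0 lem X].
  by rewrite ltn_addl // muln_gt0 C0 expn_gt0 muln_gt0 expn_gt0.
case=> [//|J Js] P /= [szJs] /andP[/eqP cJ allJs].
have ppos k : 0 < p ^ k by rewrite expn_gt0 p0.
have lem1 : 4 * p * c <= m.
  apply: leq_trans lem; rewrite expnS mulnDl; apply: (leq_trans _ (leq_addr _ _)).
  have := ppos (c.+1 * e); nia.
have lem2 : C * (2 * p * (4 * p) ^ c) ^ e <= m.
  apply: leq_trans lem; rewrite mulnDl; apply: (leq_trans _ (leq_addl _ _)).
  rewrite -[X in _ <= X]mulnA leq_mul2l; apply/orP; right.
  have -> : 2 * p * (4 * p) ^ c = 2 * 4 ^ c * p ^ c.+1.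
    rewrite expnMn expnS; lia.
  rewrite expnMn -expnM leq_mul2l; apply/orP; right.
  by rewrite expnS -{1}[p ^ _]mul1n leq_mul2r p0 orbT.
have m0 : 0 < m by apply: leq_trans lem2;
  rewrite muln_gt0 C0 expn_gt0 !muln_gt0 p0 expn_gt0 muln_gt0 p0.
pose D s := \sum_(y in J) (P (y :: s) : nat).
rewrite -box_sum_sum -/D => dens.
(* Tuples outside [E] carry at most half of the guaranteed count, so [E] itself has inverse density
   at most [2p]. *)
pose E s := m <= 2 * p * D s.
have densE : m ^ t <= 2 * p * box_sum Js E.
  have le1 : 2 * p * box_sum Js D <= 2 * p * m * box_sum Js E + m * m ^ t.
    rewrite -szJs -(box_sum_const m allJs) -!box_sumMl -box_sumD.
    apply: leq_box_sum => s _; rewrite /E; case: (leqP m (2 * p * D s)) => /= [_|/ltnW];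
      last by rewrite muln0.
    rewrite muln1; apply: leq_trans (leq_addr _ _); rewrite leq_mul2l.
    by rewrite /D card_sum -cJ; apply/orP; right; apply: subset_leq_card; apply/subsetP=> y;
      rewrite inE => /andP[].
  move: dens; rewrite expnS => dens; rewrite -(leq_pmul2l m0).
  nia.
have E0 : 0 < box_sum Js E.
  have : 0 < m ^ t by rewrite expn_gt0 m0.
  by move=> H; move: (leq_trans H densE); rewrite muln_gt0 => /andP[].
have degE s : E s -> m <= 2 * p * \sum_(y in J) P (y :: s) by [].
have [Y [sYJ cY leY]] := greedy_pick (P := fun y s => P (y :: s)) p0 m0 cJ lem1 E0 degE.
have p'0 : 0 < 2 * p * (4 * p) ^ c by rewrite !muln_gt0 p0 expn_gt0 muln_gt0 p0.
have [] := IH _ m p'0 lem2 X Js (fun s => E s && [forall y in Y, P (y :: s)]) szJs allJs.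
  by apply: (leq_trans densE); rewrite -[X in _ <= X]mulnA leq_mul2l leY orbT.
move=> Ys [szYs subYs PYs]; exists (Y :: Ys); split=> /=; first by rewrite szYs.
  by case=> [|l] //; rewrite ltnS => /subYs.
case=> [//|y s]; rewrite /in_box /= => /andP[yY sYs].
by have /andP[_ /forall_inP/(_ y yY)] := PYs s sYs.
Qed.

(** * The K-adic tree of rows *)

(* The K-adic intervals form a K-ary tree on the rows; [branches N j x] records
   which children of the height-[j.+1] interval containing [x] meet [N]. *)
Definition branches (n K : nat) (N : {set 'I_n}) (j : nat) (x : 'I_n) : {set 'I_K} :=
  [set i : 'I_K | [exists z in N, (z %/ K ^ j.+1 == x %/ K ^ j.+1) &&
                                  ((z %/ K ^ j) %% K == i)]].

Definition unbranched (n K S r : nat) (N : {set 'I_n}) (x : 'I_n) : bool :=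
  [forall j : 'I_S, #|branches K N j x| <= r].

Lemma card_unbranched (n K S r : nat) (N : {set 'I_n}) :
  0 < K -> n <= K ^ S -> #|[set x in N | unbranched K S r N x]| <= r ^ S.
Proof.
move=> K0 nKS.
set B := [set x in N | _].
(* The quotient [a] names an interval of height [j]; at [j = S] the interval [a = 0] holds all
   rows. *)
suff H j a : j <= S -> #|[set x in B | x %/ K ^ j == a]| <= r ^ j.
  apply: leq_trans (H S 0 (leqnn S)); apply: subset_leq_card; apply/subsetP=> x xB.
  by rewrite inE xB divn_small // (leq_trans (ltn_ord x) nKS).
elim: j a => [|j IH] a jS.
  rewrite expn0; apply/card_le1_eqP => x y; rewrite !inE !divn1.
  by move=> /andP[_ /eqP ex] /andP[_ /eqP ey]; apply: val_inj; rewrite /= ex ey.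
set Bj := [set x in B | _].
have [->|[x0 x0B]] := set_0Vmem Bj; first by rewrite cards0.
(* The set [branches] depends only on the interval around its point, so the single point [x0] bounds
   the number of children for all of [Bj]. *)
move: (x0B); rewrite !inE => /andP[/andP[x0N /forallP/(_ (Ordinal jS)) /= ubr] /eqP x0a].
have cov : Bj \subset \bigcup_(i in branches K N j x0)
     [set x in B | x %/ K ^ j == a * K + i].
  apply/subsetP => x xBj; move: (xBj); rewrite inE => /andP[xB /eqP xa].
  have lt : (x %/ K ^ j) %% K < K by rewrite ltn_mod.
  apply/bigcupP; exists (Ordinal lt).
    rewrite inE; apply/exists_inP; exists x; first by move: xB; rewrite inE => /andP[].
    by rewrite xa x0a /= !eqxx.
  by rewrite inE xB /= -xa expnSr divnMA -divn_eq.
apply: (leq_trans (subset_leq_card cov)).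
apply: (@leq_trans (\sum_(i in branches K N j x0) r ^ j)).
  elim/big_rec2: _ => [|i k U _ le]; first by rewrite cards0.
  apply: (leq_trans (leq_card_setU _ _)); apply: leq_add => //.
  by apply: IH; apply: ltnW.
by rewrite sum_nat_const expnS leq_mul2r ubr orbT.
Qed.

(** * Ordered chunks of a set of columns *)

Lemma sorted_enum_set (n : nat) (N : {set 'I_n}) :
  sorted (fun x y : 'I_n => x < y) (enum N).
Proof.
rewrite /enum_mem; apply: sorted_filter; first by move=> y x z; apply: ltn_trans.
by have := iota_ltn_sorted 0 n; rewrite -val_enum_ord sorted_map enumT.
Qed.

(** Chunks of the columns of a star centre act as the classes of a partite hypergraph; cutting along
    the order puts any box found in them in left-to-right order. *)
Definition chunk (n : nat) (N : {set 'I_n}) (m l : nat) : {set 'I_n} :=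
  [set y in take m (drop (l * m) (enum N))].

Definition chunks (n : nat) (N : {set 'I_n}) (m t : nat) : seq {set 'I_n} :=
  [seq chunk N m l | l <- iota 0 t].

Lemma nth_chunks (n : nat) (N : {set 'I_n}) (m t l : nat) :
  l < t -> nth set0 (chunks N m t) l = chunk N m l.
Proof. by move=> lt; rewrite (nth_map 0) ?size_iota // nth_iota. Qed.

Lemma sub_chunk (n : nat) (N : {set 'I_n}) (m l : nat) : chunk N m l \subset N.
Proof.
by apply/subsetP => y; rewrite inE => /mem_take/mem_drop; rewrite mem_enum.
Qed.

Lemma card_chunk (n : nat) (N : {set 'I_n}) (m t l : nat) :
  m * t <= #|N| -> l < t -> #|chunk N m l| = m.
Proof.
move=> le lt; have -> : #|chunk N m l| = size (take m (drop (l * m) (enum N))).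
  by rewrite cardsE; apply/card_uniqP; rewrite take_uniq ?drop_uniq ?enum_uniq.
rewrite size_takel // size_drop -cardE.
have : l.+1 * m <= t * m by rewrite leq_mul2r lt orbT.
rewrite mulSn; lia.
Qed.

Lemma ltn_chunk (n : nat) (N : {set 'I_n}) (m l l' : nat) (y y' : 'I_n) :
  l < l' -> y \in chunk N m l -> y' \in chunk N m l' -> y < y'.
Proof.
move=> lt; rewrite !inE take_drop => /mem_drop yl /mem_take y'l.
have : pairwise (fun x y : 'I_n => x < y) (enum N).
  by rewrite -sorted_pairwise ?sorted_enum_set // => a b d; apply: ltn_trans.
rewrite -(cat_take_drop (m + l * m) (enum N)) pairwise_cat => /andP[/allrelP H _].
apply: H => //; move: y'l.
have -> : l' * m = (l' - l.+1) * m + (m + l * m) by rewrite -mulSn -mulnDl subnK.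
by rewrite -drop_drop => /mem_drop.
Qed.

(** * Embedding the pattern *)

Definition common_rows (n : nat) (M : 'M[bool]_n) (s : seq 'I_n) : {set 'I_n} :=
  [set x | all (M x) s].

(** Column [b] is sent to the [b]-th element of the class [h b]. Row [a] of [A] meets each class at
    most once, so its ones lie on one transversal [tau a]; the image of [a] is a common row of
    [tau a] in the [a]-th child listed in [T]. *)
Lemma embed (t r c n K j : nat) (A : 'M[bool]_(r, c)) (h : 'I_c -> 'I_t)
    (M : 'M[bool]_n) (Ys : seq {set 'I_n}) (x : 'I_n) (T : {set 'I_K}) :
  (forall b b' : 'I_c, b <= b' -> h b <= h b') ->
  (forall (a : 'I_r) (b b' : 'I_c), h b = h b' -> A a b -> A a b' -> b = b') ->
  size Ys = t -> (forall l, l < t -> #|nth set0 Ys l| = c.+1) ->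
  (forall l l' (y y' : 'I_n), l < l' -> l' < t ->
     y \in nth set0 Ys l -> y' \in nth set0 Ys l' -> y < y') ->
  r <= #|T| ->
  (forall s, in_box s Ys -> branches K (common_rows M s) j x = T) ->
  contains M A.
Proof.
move=> hmono hrow szY cY ordY rT brY.
pose g0 l b := nth x (enum (nth set0 Ys l)) b.
have g0Y l b : l < t -> b <= c -> g0 l b \in nth set0 Ys l.
  by move=> lt bc; rewrite -mem_enum mem_nth // -cardE cY.
(* A class without a one of row [a] is filled by its element of index 0, which exists even for
   [c = 0] since classes have [c.+1] elements. *)
pose g1 a (l : nat) := if [pick b | A a b && (h b == l :> nat)] is Some b
  then g0 l (b : 'I_c) else g0 l 0.
have g1Y a l : l < t -> g1 a l \in nth set0 Ys l.
  by move=> lt; rewrite /g1; case: pickP => [b _|_]; apply: g0Y => //; apply: ltnW.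
pose tau a := [seq g1 a l | l <- iota 0 t].
have tauY a : in_box (tau a) Ys.
  rewrite /in_box all2E size_map size_iota szY eqxx /=.
  apply/(all_nthP (x, set0)) => l; rewrite size_zip size_map size_iota szY minnn => lt.
  rewrite nth_zip ?size_map ?size_iota //= (nth_map 0) ?size_iota // nth_iota //.
  exact: g1Y.
have ex_f (a : 'I_r) : exists z : 'I_n, [&& z \in common_rows M (tau a),
    z %/ K ^ j.+1 == x %/ K ^ j.+1 &
    (z %/ K ^ j) %% K == enum_val (widen_ord rT a)].
  have : enum_val (widen_ord rT a) \in branches K (common_rows M (tau a)) j x.
    by rewrite (brY _ (tauY a)) enum_valP.
  rewrite inE.
  by case/exists_inP => z zc H; exists z; rewrite zc.
have [f fP] := fin_all_exists ex_f.
apply/existsP; exists [ffun a => f a].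
apply/existsP; exists [ffun b : 'I_c => g0 (h b) b].
apply/and3P; split.
- apply/forallP => a; apply/forallP => a'; apply/implyP => lt; rewrite !ffunE.
  have /and3P[_ /eqP qa /eqP ma] := fP a; have /and3P[_ /eqP qa' /eqP ma'] := fP a'.
  have ltT : enum_val (widen_ord rT a) < enum_val (widen_ord rT a').
    have e0 := enum_val (widen_ord rT a).
    rewrite (enum_val_nth e0) (enum_val_nth e0 (widen_ord rT a')).
    apply: (sorted_ltn_nth (leT := fun x y : 'I_K => x < y)) => //=.
    + by move=> ? ? ?; apply: ltn_trans.
    + exact: sorted_enum_set.
    + by rewrite inE -cardE (leq_trans (ltn_ord a)).
    + by rewrite inE -cardE (leq_trans (ltn_ord a')).
  (* Both rows share the parent interval, so the order of the children decides the order of the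
     rows. *)
  have ltK : f a %/ K ^ j < f a' %/ K ^ j.
    rewrite (divn_eq (f a %/ K ^ j) K) (divn_eq (f a' %/ K ^ j) K) ma ma'.
    by rewrite -!divnMA -!expnSr qa qa' ltn_add2l.
  by rewrite ltnNge; apply: contraL ltK => /(leq_div2r (K ^ j)); rewrite -leqNgt.
- apply/forallP => b; apply/forallP => b'; apply/implyP => lt; rewrite !ffunE.
  have [hlt|heq] : h b < h b' \/ h b = h b'.
    have := hmono _ _ (ltnW lt); rewrite leq_eqVlt => /orP[/eqP/val_inj|]; by [right|left].
  + apply: (ordY (h b) (h b')) => //.
      by apply: g0Y => //; apply: ltnW.
    by apply: g0Y => //; apply: ltnW.
  + rewrite heq /g0.
    apply: (sorted_ltn_nth (leT := fun x y : 'I_n => x < y)) => //.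
    * by move=> ? ? ?; apply: ltn_trans.
    * exact: sorted_enum_set.
    * by rewrite inE -cardE cY // ltnW // ltnS.
    * by rewrite inE -cardE cY // ltnW // ltnS.
- apply/forallP => a; apply/forallP => b; apply/implyP => Aab; rewrite !ffunE.
  have /and3P[+ _ _] := fP a; rewrite inE => /allP; apply.
  apply/mapP; exists (h b : nat); first by rewrite mem_iota /= ltn_ord.
  rewrite /g1; case: pickP => [b' /andP[Aab' /eqP/val_inj hb']|/(_ b)].
    by rewrite (hrow a b' b hb' Aab' Aab).
  by rewrite Aab eqxx.
Qed.

(** * Finding a row with many good stars *)

Lemma pigeonhole_sum (I : finType) (F : I -> nat) (a k : nat) :
  0 < a -> a <= k * \sum_i F i -> exists i, a <= k * #|I| * F i.
Proof.
move=> a0 le; have [/existsP[i lei]|/existsPn none] :=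
  boolP [exists i, a <= k * #|I| * F i]; first by exists i.
have : k * #|I| * \sum_i F i <= \sum_(i : I) a.-1.
  rewrite big_distrr; apply: leq_sum => i _; move: (none i).
  by rewrite -ltnNge => lt; rewrite -ltnS prednK.
rewrite sum_nat_const -[#|xpredT|]/#|I|.
case: (posnP #|I|) => [I0|I0].
  suff F0 : \sum_i F i = 0 by move: le; rewrite F0 muln0 leqNgt a0.
  by apply: big1 => i; have := card0_eq I0 i.
nia.
Qed.

Lemma weight_sum (n : nat) (M : 'M[bool]_n) :
  weight M = \sum_x #|[set y | M x y]|.
Proof.
rewrite /weight -sum1dep_card -(pair_big_dep predT (fun x y => M x y) (fun _ _ => 1)) /=.
by apply: eq_bigr => x _; rewrite sum1dep_card.
Qed.

(** Terms below [D] add up to at most half of the assumed total, and each remaining term gains a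
    factor of at least [D ^ t]. *)
Lemma sum_expn_ge (I : finType) (d : I -> nat) (D t : nat) :
  0 < #|I| -> 2 * #|I| * D <= \sum_i d i ->
  #|I| * D ^ t.+1 <= \sum_(i | D <= d i) d i ^ t.+1.
Proof.
move=> I0 le.
have le1 : #|I| * D <= \sum_(i | D <= d i) d i.
  have le2 : \sum_i d i <= \sum_(i | D <= d i) d i + #|I| * D.
    rewrite (bigID (fun i => D <= d i)) /= leq_add2l -sum_nat_const.
    rewrite [X in _ <= X](bigID (fun i => D <= d i)) /=.
    apply: leq_trans (leq_addl _ _); apply: leq_sum => i; rewrite -ltnNge; exact: ltnW.
  by move: le; rewrite -mulnA mul2n -addnn => le;
    rewrite -(leq_add2r (#|I| * D)) (leq_trans le).
apply: (@leq_trans (D ^ t * \sum_(i | D <= d i) d i)).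
  by rewrite expnSr mulnCA leq_mul2l le1 orbT.
rewrite big_distrr; apply: leq_sum => i Di /=.
rewrite expnSr leq_mul2r; apply/orP; right.
by case: (posnP t) => [->|t0] //; rewrite leq_exp2r.
Qed.

(** Double counting of bad stars: a fixed tuple has at most [r ^ S] bad centres, whereas bad
    majorities at all rows of degree at least [D] would give too many bad stars. *)
Lemma branched_row (n t r K S D : nat) (M : 'M[bool]_n) :
  0 < n -> 0 < K -> n <= K ^ S -> t.+1 <= D ->
  2 * (2 * t.+1) ^ t.+1 * r ^ S * n ^ t < D ^ t.+1 ->
  2 * n * D <= weight M ->
  exists x : 'I_n, let N := [set y | M x y] in let m := #|N| %/ t.+1 in
    D <= #|N| /\ m ^ t.+1 <= 2 * box_sum (chunks N m t.+1)
      (fun s => ~~ unbranched K S r (common_rows M s) x).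
Proof.
move=> n0 K0 nKS tD dens wM.
pose N x := [set y | M x y]; pose m x := #|N x| %/ t.+1.
pose Js x := chunks (N x) (m x) t.+1.
pose bad x s := unbranched K S r (common_rows M s) x.
have [/existsP[x /andP[Dx lex]]|/existsPn none] := boolP [exists x : 'I_n,
    (D <= #|N x|) && (m x ^ t.+1 <= 2 * box_sum (Js x) (fun s => ~~ bad x s))].
  by exists x.
exfalso.
have szJs x : size (Js x) = t.+1 by rewrite size_map size_iota.
have cJs x : all (fun J : {set 'I_n} => #|J| == m x) (Js x).
  apply/(all_nthP set0) => l; rewrite szJs => lt; rewrite nth_chunks //.
  by apply/eqP; apply: card_chunk lt; rewrite leq_divM.
have bad_large x : D <= #|N x| -> m x ^ t.+1 <= 2 * box_sum (Js x) (bad x).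
  move=> Dx; have := none x; rewrite Dx andTb -ltnNge.
  have : box_sum (Js x) (bad x) + box_sum (Js x) (fun s => ~~ bad x s) = m x ^ t.+1.
    rewrite -box_sumD -(szJs x) -[RHS]mul1n -(box_sum_const 1 (cJs x)).
    by apply: eq_box_sum => s; case: (bad x s).
  lia.
have bad_small : \sum_x box_sum (Js x) (bad x) <= r ^ S * n ^ t.+1.
  apply: (@leq_trans (\sum_x box_sum (nseq t.+1 setT)
      (fun s => (x \in common_rows M s) && bad x s : nat))).
    apply: leq_sum => x _; rewrite box_sum_setT szJs.
    apply: leq_box_sum => s _; rewrite -mulnb leq_mul2r; apply/orP; right.
    case sJs: (in_box s (Js x)) => //; rewrite lt0b inE.
    apply/(all_nthP x) => l ls.
    have szs : size s = size (Js x) by move: sJs; rewrite /in_box all2E => /andP[/eqP].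
    move: sJs; rewrite /in_box all2E szs eqxx => /(all_nthP (x, set0))/(_ l).
    rewrite size_zip szs minnn -szs => /(_ ls); rewrite nth_zip //=.
    have lt : l < t.+1 by rewrite -(szJs x) -szs.
    rewrite nth_chunks // => /(subsetP (sub_chunk _ _ _)).
    by rewrite inE.
  rewrite -box_sum_sum.
  have cT : all (fun J : {set 'I_n} => #|J| == n) (nseq t.+1 setT).
    by rewrite all_nseq cardsT card_ord eqxx.
  have := box_sum_const (r ^ S) cT; rewrite size_nseq => <-.
  apply: leq_box_sum => s _; apply: leq_trans (card_unbranched r (common_rows M s) K0 nKS).
  by rewrite -card_sum [X in _ <= X]big_mkcond leq_sum // => x _; case: (x \in _).
have large : n * D ^ t.+1 <= \sum_(x | D <= #|N x|) #|N x| ^ t.+1.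
  by have := @sum_expn_ge 'I_n (fun x => #|N x|) D t; rewrite card_ord; apply;
    rewrite // -weight_sum.
have : n * D ^ t.+1 <= (2 * t.+1) ^ t.+1 * (2 * (r ^ S * n ^ t.+1)).
  apply: (leq_trans large).
  apply: (@leq_trans ((2 * t.+1) ^ t.+1 * (2 * \sum_(x | D <= #|N x|) box_sum (Js x) (bad x)))).
    rewrite !big_distrr; apply: leq_sum => x Dx /=.
    apply: leq_trans (leq_mul (leqnn _) (bad_large x Dx)).
    (* Rounding costs a factor of at most 2: [#|N x| <= 2 * t.+1 * m x], as the degree is at least
       [t.+1]. *)
    rewrite -expnMn leq_exp2r //.
    have mx0 : 0 < m x by rewrite divn_gt0 // (leq_trans tD).
    rewrite [X in X <= _](divn_eq #|N x| t.+1) -/(m x) -mulnA mul2n -addnn mulnC.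
    by rewrite leq_add2l (leq_trans (ltnW (ltn_pmod _ (ltn0Sn t)))) // leq_pmulr.
  rewrite !leq_mul2l; apply/orP; right; apply: leq_trans bad_small.
  by rewrite [X in _ <= X](bigID (fun x => D <= #|N x|)) leq_addr.
apply/negP; rewrite -ltnNge.
have -> : (2 * t.+1) ^ t.+1 * (2 * (r ^ S * n ^ t.+1)) =
          n * (2 * (2 * t.+1) ^ t.+1 * r ^ S * n ^ t) by rewrite [n ^ t.+1]expnS; lia.
by rewrite ltn_pmul2l.
Qed.

(** * The finite form of the theorem *)

Lemma dense_contains (t r c : nat) (A : 'M[bool]_(r, c)) :
  col_partite t.+1 A ->
  exists C e : nat, 0 < C /\ forall (n K S D : nat) (M : 'M[bool]_n),
    0 < n -> 0 < K -> n <= K ^ S -> 0 < S ->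
    t.+1 * (C * (2 * (S * 2 ^ K)) ^ e) <= D ->
    2 * (2 * t.+1) ^ t.+1 * r ^ S * n ^ t < D ^ t.+1 ->
    2 * n * D <= weight M -> contains M A.
Proof.
case=> h [hmono hrow].
have [C [e [C0 boxP]]] := dense_box c.+1 t.+1.
exists C, e; split=> // n K S D M n0 K0 nKS S0 leD dens wM.
have p0 : 0 < 2 * (S * 2 ^ K) by rewrite !muln_gt0 S0 expn_gt0.
have tD : t.+1 <= D.
  by apply: leq_trans leD; rewrite leq_pmulr // muln_gt0 C0 expn_gt0 p0.
have [x [DN good]] := branched_row n0 K0 nKS tD dens wM.
set N := [set y | M x y] in DN good; set m := #|N| %/ t.+1 in good.
have lem : C * (2 * (S * 2 ^ K)) ^ e <= m.
  by rewrite leq_divRL // mulnC (leq_trans leD).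
have m0 : 0 < m by apply: leq_trans lem; rewrite muln_gt0 C0 expn_gt0 p0.
pose Js := chunks N m t.+1.
have szJs : size Js = t.+1 by rewrite size_map size_iota.
have cJs : all (fun J : {set 'I_n} => #|J| == m) Js.
  apply/(all_nthP set0) => l; rewrite szJs => lt; rewrite nth_chunks //.
  by apply/eqP; apply: card_chunk lt; rewrite leq_divM.
(* A good star is classified by a branching height and the children met there. The [S * 2 ^ K]
   classes and the loss of half the stars give the inverse density [2 * (S * 2 ^ K)]. *)
pose Q (v : 'I_S * {set 'I_K}) s :=
  (branches K (common_rows M s) v.1 x == v.2) && (r < #|v.2|).
have le1 : m ^ t.+1 <= 2 * \sum_v box_sum Js (Q v).
  apply: (leq_trans good); rewrite leq_pmul2l //.
  have <- := box_sum_sum Js predT (fun v s => Q v s : nat).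
  apply: leq_box_sum => s _; case: (boolP (unbranched _ _ _ _ _)) => //=.
  case/forallPn => j; rewrite -ltnNge => lt.
  rewrite (bigD1 (j, branches K (common_rows M s) j x)) //= /Q /= eqxx lt.
  by rewrite leq_addr.
have m0' : 0 < m ^ t.+1 by rewrite expn_gt0 m0.
have [[j T]] := pigeonhole_sum m0' le1.
rewrite card_prod card_ord -[#|{: {set _}}|]cardsT -powersetT card_powerset cardsT card_ord => le2.
have [Ys [szY subY PY]] := boxP _ _ p0 lem _ _ _ szJs cJs le2.
(* A class with [#|T| <= r] is empty, but the chosen one has a positive count. *)
have Tr : r < #|T|.
  have : 0 < box_sum Js (Q (j, T)).
    by move: (leq_trans m0' le2); rewrite muln_gt0 => /andP[].
  rewrite ltnNge; apply: contraR; rewrite -leqNgt => Tle.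
  rewrite -[X in _ <= X](mul0n (m ^ size Js)) -(box_sum_const 0 cJs).
  by apply: leq_box_sum => s _; rewrite /Q /= ltnNge Tle andbF.
apply: (@embed t.+1 r c n K j A h M Ys x T) => // [l lt|||s /PY/andP[/eqP]] //.
- by have [] := subY l lt.
- move=> l l' y y' ll' l't yl y'l'.
  have [/subsetP sl _] := subY l (ltn_trans ll' l't).
  have [/subsetP sl' _] := subY l' l't.
  move: (sl _ yl) (sl' _ y'l'); rewrite !nth_chunks ?(ltn_trans ll' l't) //.
  exact: ltn_chunk.
- exact: ltnW.
Qed.

(** * Growth estimates and the passage to real exponents *)

(** With [q = S %/ e.+1], the bounds [S < (q+1)(e+1)] and [q+1 <= 2^q] control [S ^ e.+1]; the spare
    factor [S] absorbs [a]. *)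
Lemma poly_leq_exp2 (a e : nat) :
  exists S0, forall S, S0 <= S -> a * S ^ e <= 2 ^ S.
Proof.
exists (a * e.+1 ^ e.+1) => S leS.
have j0 : 0 < e.+1 ^ e.+1 by rewrite expn_gt0.
have le1 : S ^ e.+1 <= e.+1 ^ e.+1 * 2 ^ S.
  apply: (@leq_trans (((S %/ e.+1).+1 * e.+1) ^ e.+1)).
    by rewrite leq_exp2r // ltnW // ltn_ceil.
  rewrite expnMn mulnC leq_mul2l; apply/orP; right.
  apply: (@leq_trans ((2 ^ (S %/ e.+1)) ^ e.+1)); first by rewrite leq_exp2r // ltn_expl.
  by rewrite -expnM leq_exp2l // leq_divM.
rewrite -(leq_pmul2l j0); apply: leq_trans le1.
by rewrite mulnA [_ * a]mulnC [S ^ _.+1]expnS leq_mul2r leS orbT.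
Qed.

Lemma poly_log_leq (a e K : nat) : 1 < K ->
  (* The doubled constant pays for the [.+1] in the exponent [(trunc_log K n).+1]. *)
  exists n0, forall n, n0 <= n -> a * (trunc_log K n).+1 ^ e <= n.
Proof.
move=> K1; have [S0 HS] := poly_leq_exp2 (2 * a) e.
exists (K ^ S0) => n len.
have n0 : 0 < n by apply: leq_trans len; rewrite expn_gt0 (ltnW K1).
have leS : S0 <= trunc_log K n by apply: trunc_log_max.
have := HS _ (leqW leS); rewrite expnS -mulnA leq_pmul2l // => /leq_trans; apply.
apply: leq_trans (trunc_logP K1 n0).
by case: (posnP (trunc_log K n)) => [->//|l0]; rewrite leq_exp2r.
Qed.

(* Imported only here because it rebinds [^] on [nat] to [Nat.pow]. *)
From Stdlib Require Import Reals Lra.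

Lemma INR_expn (a b : nat) : INR (expn a b) = (INR a ^ b)%R.
Proof.
by elim: b => [|b IH] //; rewrite expnS;
  change (INR (Nat.mul a (expn a b)) = INR a * INR a ^ b)%R; rewrite mult_INR IH.
Qed.

Lemma INR_muln (a b : nat) : INR (a * b) = (INR a * INR b)%R.
Proof. exact: mult_INR. Qed.

Lemma INR_leq (a b : nat) : (a <= b)%N -> (INR a <= INR b)%R.
Proof. by move=> /leP; apply: le_INR. Qed.

Lemma leq_INR (a b : nat) : (INR a <= INR b)%R -> (a <= b)%N.
Proof. by move=> /INR_le/leP. Qed.

Lemma ltn_INR (a b : nat) : (INR a < INR b)%R -> (a < b)%N.
Proof. by move=> /INR_lt/ltP. Qed.

Lemma nat_floor (y : R) : (0 <= y)%R ->
  exists D : nat, (INR D <= y)%R /\ (y < INR D + 1)%R.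
Proof.
move=> y0; have [up1 up2] := archimed y.
have z0 : Z.le 0 (up y - 1).
  have : Z.lt 0 (up y) by apply: lt_IZR; lra.
  lia.
exists (Z.to_nat (up y - 1)).
rewrite INR_IZR_INZ Znat.Z2Nat.id // minus_IZR; split; lra.
Qed.

Lemma Rpower_unbounded (d z : R) : (0 < d)%R ->
  exists n0 : nat, forall n : nat, (n0 <= n)%N -> (z < Rpower (INR n) d)%R.
Proof.
move=> d0; have z0 : (0 < Rabs z + 1)%R by have := Rabs_pos z; lra.
have [n0 Hn0] := INR_unbounded (Rpower (Rabs z + 1) (/ d)).
exists n0 => n /INR_leq len.
have zz : (z < Rabs z + 1)%R by have := Rle_abs z; lra.
apply: Rlt_trans zz _.
have -> : (Rabs z + 1 = Rpower (Rpower (Rabs z + 1) (/ d)) d)%R.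
  by rewrite Rpower_mult Rinv_l ?Rpower_1 //; lra.
apply: Rlt_Rpower_l => //; split; [exact: exp_pos | lra].
Qed.

Lemma Rpower_pow_INR (x y : R) (k : nat) :
  (Rpower x y ^ k = Rpower x (y * INR k))%R.
Proof. by rewrite -Rpower_mult Rpower_pow //; apply: exp_pos. Qed.

Theorem theorem1p2 (t : nat) (ht : (2 <= t)%N) (r c : nat) (A : 'M[bool]_(r, c)) :
  txt_partite t A ->
  forall eps : R, (0 < eps)%R ->
  exists n0 : nat, forall n : nat, (n0 <= n)%N ->
    (INR (ex n A) < Rpower (INR n) (2 - 1 / INR t + eps))%R.
Proof.
case=> _ colA eps eps0.
have [t' tE] : exists t', t = t'.+1 by exists t.-1; rewrite prednK // ltnW.
have T2 : (2 <= INR t)%R by have := INR_leq ht.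
rewrite tE in colA.
have [C [e [C0 HA]]] := dense_contains colA.
set T := INR t in T2 *.
(* The surplus [n^(T*eps)] is split into two factors [n^d]: one pays for [r ^ S], the other for the
   constants. *)
pose d := (T * eps / 2)%R.
have d0 : (0 < d)%R by rewrite /d; nra.
have [K0 HK0] := Rpower_unbounded (INR r.+1) d0.
pose K := maxn K0 2.
have K1 : (1 < K)%N by rewrite leq_max orbT.
have rK : (INR r.+1 < Rpower (INR K) d)%R by apply: HK0; rewrite leq_max leqnn.
(* Chosen so that [a * S ^ e] is 8 times the lower bound required of [D]; squaring lets it be
   compared with [sqrt n] inside the integers. *)
pose a := (8 * (t * (C * expn (2 * expn 2 K) e)))%N.
have [n1 Hn1] := poly_log_leq (a * a) (e * 2) K1.
(* In [16 * T], the 8 comes from [D >= y/8] and [2 * T] from the chunk sizes. *)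
have [n2 Hn2] := Rpower_unbounded (2 * (16 * T) ^ t * INR r.+1) d0.
exists (maxn 64 (maxn n1 n2)) => n;
  rewrite !geq_max => /andP[n64 /andP[/Hn1 {}Hn1 /Hn2 {}Hn2]].
have n0 : (0 < n)%N by apply: leq_trans n64.
set N := INR n in Hn2 *.
have N64 : (64 <= N)%R by have := INR_leq n64; rewrite (_ : INR 64 = 64%R) //;
  rewrite INR_IZR_INZ.
pose b := (1 - 1 / T + eps)%R; pose y := Rpower N b.
(* Since [T >= 2], the exponent [b] is at least 1/2. *)
have sqrt_y : (sqrt N <= y)%R.
  rewrite -Rpower_sqrt; last lra.
  apply: Rle_Rpower; first lra.
  have : (/ T <= / 2)%R by apply: Rinv_le_contravar; lra.
  rewrite /b; lra.
have sqrt8 : (8 <= sqrt N)%R.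
  by rewrite -(sqrt_square 8); [apply: sqrt_le_1; lra | lra].
(* As [y >= 8], rounding [y/4] down leaves [D >= y/8], while [D <= y/4] keeps [2nD] below
   [n * y]. *)
have [D [Dle Dgt]] : exists D : nat, (INR D <= y / 4)%R /\ (y / 4 < INR D + 1)%R.
  by apply: nat_floor; lra.
pose S := (trunc_log K n).+1.
suff exD : (ex n A <= 2 * n * D)%N.
  apply: Rle_lt_trans (INR_leq exD) _; rewrite !INR_muln -/N (_ : INR 2 = 2%R) //.
  have -> : (2 - 1 / T + eps = 1 + b)%R by rewrite /b; ring.
  rewrite Rpower_plus Rpower_1 -/y; last lra.
  nra.
apply/bigmax_leqP => M; apply: contraR; rewrite -ltnNge => /ltnW.
apply: (HA n K S D M) => //.
- exact: ltnW.
- by apply: ltnW; apply: trunc_log_ltn.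
- rewrite -tE.
  set Z := (t * _)%N.
  have sqZ : (8 * Z * (8 * Z) <= n)%N.
    have -> : (8 * Z = a * expn S e)%N by rewrite /Z /a (mulnCA 2 S) [expn (S * _) _]expnMn [(expn S e * _)%N]mulnC !mulnA.
    by rewrite mulnACA [(expn S e * _)%N]mulnn -expnM.
  have : (INR (8 * Z) <= sqrt N)%R.
    rewrite -(sqrt_square (INR (8 * Z))); last exact: pos_INR.
    apply: sqrt_le_1_alt; rewrite -INR_muln; exact: INR_leq.
  rewrite INR_muln (_ : INR 8 = 8%R); last by rewrite INR_IZR_INZ.
  move=> leZ; apply: leq_INR; lra.
- rewrite -tE; apply: ltn_INR.
  have D8 : (y / 8 <= INR D)%R by lra.
  rewrite INR_expn; apply: Rlt_le_trans (pow_incr _ _ t (conj _ D8)); last lra.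
  (* Each factor [r] is below [K^d] and [K ^ trunc_log K n <= n]; the extra level in [S] costs the
     factor [r.+1]. *)
  have rS : (INR r ^ S <= INR r.+1 * Rpower N d)%R.
    apply: (Rle_trans _ (INR r.+1 ^ S)).
      by apply: pow_incr; split; [exact: pos_INR | apply: INR_leq].
    rewrite /S -tech_pow_Rmult; apply: Rmult_le_compat_l; first exact: pos_INR.
    apply: (Rle_trans _ (Rpower (INR K) d ^ trunc_log K n)).
      by apply: pow_incr; split; [exact: pos_INR | lra].
    have K0' : (0 < INR K)%R by apply: (lt_INR 0); apply/ltP; apply: ltnW.
    rewrite Rpower_pow_INR Rmult_comm -Rpower_mult Rpower_pow // -INR_expn.
    apply: Rle_Rpower_l; first lra.
    split; first by apply: (lt_INR 0); apply/ltP; rewrite expn_gt0 (ltnW K1).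
    by apply: INR_leq; apply: trunc_logP.
  (* The exponent is [T * b = T - 1 + T * eps = t' + 2d]. *)
  have -> : ((y / 8) ^ t = Rpower N d * Rpower N d * N ^ t' / 8 ^ t)%R.
    rewrite Rpow_mult_distr pow_inv /Rdiv; congr (_ * _)%R.
    rewrite /y Rpower_pow_INR -(Rpower_pow t'); last lra.
    rewrite -!Rpower_plus; congr Rpower.
    have : T = (INR t' + 1)%R by rewrite /T tE S_INR.
    rewrite -/T /b /d => T't; rewrite (_ : INR t' = T - 1)%R; last lra.
    by field; lra.
  rewrite !INR_muln !INR_expn INR_muln -/N -/T (_ : INR 2 = 2%R) //.
  have P0 : (0 < N ^ t')%R by apply: pow_lt; lra.
  have E0 : (0 < 8 ^ t)%R by apply: pow_lt; lra.
  have T0 : (0 < (2 * T) ^ t)%R by apply: pow_lt; lra.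
  apply: (Rmult_lt_reg_r (8 ^ t)) => //.
  have Wt W : (W / 8 ^ t * 8 ^ t = W)%R by field; lra.
  rewrite Wt.
  have dpos : (0 < Rpower N d)%R by apply: exp_pos.
  have E16 : ((16 * T) ^ t = 8 ^ t * (2 * T) ^ t)%R.
    by rewrite -Rpow_mult_distr; congr (_ ^ _)%R; ring.
  rewrite E16 in Hn2.
  have r0 : (0 <= INR r.+1)%R by apply: pos_INR.
  apply: (Rle_lt_trans _ (2 * (8 ^ t * (2 * T) ^ t) * INR r.+1 * Rpower N d * N ^ t')).
    have W0 : (0 <= 2 * (8 ^ t * (2 * T) ^ t) * N ^ t')%R.
      by apply: Rmult_le_pos; last lra; apply: Rmult_le_pos; first lra; apply: Rmult_le_pos;
        lra.
    have := Rmult_le_compat_l _ _ _ W0 rS; lra.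
  have := Rmult_lt_compat_r _ _ _ (Rmult_lt_0_compat _ _ dpos P0) Hn2; lra.
Qed.
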